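(* Let $G$ be a finite group and let $\alpha\in\mathrm{Aut}(G)$ be an AI-automorphism. Let $\Phi_\alpha\colon\tau(G)\to G^3$ be the homomorphism induced by $$G\star G^\ast\to G^3,\quad g_1h_1^\ast\cdots g_kh_k^\ast\mapsto (g_1\cdots g_k,\ h_1\cdots h_k,\ \alpha(g_1h_1\cdots g_kh_k)),$$ and let $\kappa\colon G\wedge G=[G,G^\ast]_{\tau(G)}\to G'$ be the commutator map, $g\wedge h\mapsto [g,h]$. Then $$\operatorname{im}\Phi_\alpha=K(G,3)\quad\text{and}\quad \ker\Phi_\alpha=\ker\kappa\leq Z(\tau(G)).$$
   Context: Conventions: $[g,h]=g^{-1}h^{-1}gh$, $g^h=h^{-1}gh$, and $G'$ is the commutator subgroup. Let $G^\ast$ be an isomorphic copy of $G$ via $g\mapsto g^\ast$, and let $G\star G^\ast$ be the free product. The group $\nu(G)$ is the quotient of $G\star G^\ast$ by the normal closure of all elements $[x,y^\ast]^z[x^z,(y^z)^\ast]^{-1}$ and $[x,y^\ast]^{(z^\ast)}[x^z,(y^z)^\ast]^{-1}$ with $x,y,z\in G$. Put $\nabla(G)=\langle [x,x^\ast]: x\in G\rangle\leq \nu(G)$ and $\tau(G)=\nu(G)/\nabla(G)$. Elements of $G$ and $G^\ast$ are identified with their images. The non-abelian exterior square $G\wedge G$ is identified with the subgroup $[G,G^\ast]_{\tau(G)}$ of $\tau(G)$ (which is the kernel of the map $\tau(G)\to G\times G$ induced by $g_1h_1^\ast\cdots g_kh_k^\ast\mapsto(g_1\cdots g_k,h_1\cdots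 h_k)$), with $g\wedge h=[g,h^\ast]$. $K(G,n)=\{(g_1,\ldots,g_n)\in G^n: g_1\cdots g_n\in G'\}$. An AI-automorphism of $G$ is an automorphism of $G$ that induces the inversion automorphism on the abelianisation $G/G'$. *)

(* Defs.v *)
From HB Require Import structures.
From mathcomp Require Import all_boot all_fingroup all_solvable.
From mathcomp Require Import boolp classical_sets.

Set Implicit Arguments.
Unset Strict Implicit.
Unset Printing Implicit Defensive.

Local Open Scope group_scope.
Local Open Scope quotient_scope.
Local Open Scope classical_set_scope.

(* fingroup also has a repr *)
Local Notation repr := generic_quotient.repr.

(* Recall x ^ y = y^-1 * (x * y) and [~ x, y] = x^-1 * (x ^ y), that is,      *)
(* x^-1 * y^-1 * x * y.                                                       *)

Notation "{ 'hom' G -> H }" := (UMagmaMorphism.type G%type H%type)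
  (at level 0, G at level 98, H at level 99, format "{ 'hom'  G  ->  H }")
  : type_scope.

Section Subgroups.
Variable T : groupType.
Implicit Types (A S : set T) (x y z : T).

Definition is_subgroup A :=
  [/\ A 1, forall x y, A x -> A y -> A (x * y) & forall x, A x -> A x^-1].

Definition is_normal_subgroup A :=
  is_subgroup A /\ forall x y, A x -> A (x ^ y).

Definition subgroup_gen S : set T := smallest is_subgroup S.

Definition normal_closure S : set T := smallest is_normal_subgroup S.

Definition group_center : set T := [set z | forall t, commute z t].

Lemma subgroup_gen_subgroup S : is_subgroup (subgroup_gen S).
Proof.
split; first by move=> A [[]].
- by move=> x y Sx Sy A [sgA SA]; case: (sgA) => _ AM _; apply: AM;
    [apply: Sx | apply: Sy].
- by move=> x Sx A [sgA SA]; case: (sgA) => _ _ AV; apply: AV; apply: Sx.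
Qed.

Lemma sub_subgroup_gen S : S `<=` subgroup_gen S.
Proof. exact: sub_gen_smallest. Qed.

Lemma normal_closure_normal S : is_normal_subgroup (normal_closure S).
Proof.
split; first split; first by move=> A [[[]]].
- by move=> x y Sx Sy A [nA SA]; case: (nA) => -[_ AM _] _; apply: AM;
    [apply: Sx | apply: Sy].
- by move=> x Sx A [nA SA]; case: (nA) => -[_ _ AV] _; apply: AV; apply: Sx.
- by move=> x y Sx A [nA SA]; case: (nA) => _ AJ; apply: AJ; apply: Sx.
Qed.

Lemma sub_normal_closure S : S `<=` normal_closure S.
Proof. exact: sub_gen_smallest. Qed.

End Subgroups.

Arguments group_center T : clear implicits.

Record subgroup (T : groupType) := Subgroup {
  subgroup_set :> set T;
  subgroupP : is_subgroup subgroup_set }.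

Record normal_subgroup (T : groupType) := NormalSubgroup {
  normal_set :> set T;
  normal_subgroupP : is_normal_subgroup normal_set }.

Definition hom_ker (G H : groupType) (f : {hom G -> H}) : set G :=
  [set x | f x = 1].

Lemma hom_ker_normal (G H : groupType) (f : {hom G -> H}) :
  is_normal_subgroup (hom_ker f).
Proof.
split; first split=> [|x y fx fy|x fx]; rewrite /hom_ker /=.
- exact: gmulf1.
- by rewrite gmulfM fx fy mulg1.
- by rewrite gmulfV fx invg1.
- by move=> x y fx; rewrite gmulfJ fx conj1g.
Qed.

Section SubgroupGroup.
Variables (T : groupType) (A : subgroup T).

Definition subgroup_pred : pred T := [pred x | `[< subgroup_set A x >]].

Fact subgroup_pred_closed : group_closed subgroup_pred.
Proof.
have [A1 AM AV] := subgroupP A.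
split; first exact/asboolP.
move=> x y /asboolP Ax /asboolP Ay.
by apply/asboolP; apply: AM => //; apply: AV.
Qed.

Record subgroup_of : Type := SubgroupElt {
  subgroup_val : T;
  _ : subgroup_pred subgroup_val }.

HB.instance Definition _ := [isSub for subgroup_val].
HB.instance Definition _ := [Choice of subgroup_of by <:].
HB.instance Definition _ :=
  SubChoice_isSubGroup.Build T subgroup_pred subgroup_of subgroup_pred_closed.

Lemma subgroup_ofP (x : subgroup_of) : subgroup_set A (val x).
Proof. exact/asboolP/(valP x). Qed.

End SubgroupGroup.

Section QuotientGroup.
Variables (T : groupType) (N : normal_subgroup T).

Definition coset_rel : rel T := fun x y => `[< normal_set N (x^-1 * y) >].

Fact coset_rel_equiv : equiv_class_of coset_rel.
Proof.
have [[N1 NM NV] NJ] := normal_subgroupP N.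
split=> [x|x y|y x z].
- by apply/asboolP; rewrite mulVg.
- apply: asbool_equiv_eq.
  by split=> /NV; rewrite invgM invgK.
- move=> /asboolP Nxy /asboolP Nyz; apply/asboolP.
  by have := NM _ _ Nxy Nyz; rewrite mulgA mulgK.
Qed.

Canonical coset_equiv := EquivRelPack coset_rel_equiv.

Definition quotient_group : Type := {eq_quot coset_equiv}.

HB.instance Definition _ := Choice.on quotient_group.
HB.instance Definition _ := EqQuotient.on quotient_group.

Let pi : T -> quotient_group := \pi_quotient_group.

Lemma quotient_eqP x y : pi x = pi y <-> normal_set N (x^-1 * y).
Proof. by split=> [/eqmodP/asboolP|/asboolP xy] //; apply/eqmodP. Qed.

Definition quotient_mul (x y : quotient_group) := pi (repr x * repr y).
Definition quotient_inv (x : quotient_group) := pi (repr x)^-1.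
Definition quotient_one := pi 1.

Fact quotient_mulE x y : quotient_mul (pi x) (pi y) = pi (x * y).
Proof.
have [[N1 NM NV] NJ] := normal_subgroupP N.
rewrite /quotient_mul; apply/quotient_eqP.
have /quotient_eqP Nx : pi (repr (pi x)) = pi x by rewrite /pi reprK.
have /quotient_eqP Ny : pi (repr (pi y)) = pi y by rewrite /pi reprK.
move: (repr (pi x)) (repr (pi y)) Nx Ny => a b Nx Ny.
have -> : (a * b)^-1 * (x * y) = (a^-1 * x) ^ b * (b^-1 * y).
  by rewrite /conjg invgM !mulgA mulgK.
by apply: NM => //; apply: NJ.
Qed.

Fact quotient_invE x : quotient_inv (pi x) = pi x^-1.
Proof.
have [[N1 NM NV] NJ] := normal_subgroupP N.
rewrite /quotient_inv; apply/quotient_eqP.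
have /quotient_eqP Nx : pi (repr (pi x)) = pi x by rewrite /pi reprK.
move: (repr _) Nx => a Nx.
have -> : a^-1^-1 * x^-1 = ((a^-1 * x)^-1) ^ a^-1.
  by rewrite /conjg invgM !invgK !mulgA mulgK.
by apply: NJ; apply: NV.
Qed.

Fact quotient_ind (P : quotient_group -> Prop) :
  (forall x, P (pi x)) -> forall q, P q.
Proof. by move=> Ppi q; rewrite -[q]reprK. Qed.

Fact quotient_mulA : associative quotient_mul.
Proof.
by elim/quotient_ind=> x; elim/quotient_ind=> y; elim/quotient_ind=> z;
  rewrite !quotient_mulE mulgA.
Qed.

Fact quotient_mul1 : left_id quotient_one quotient_mul.
Proof. by elim/quotient_ind=> x; rewrite quotient_mulE mul1g. Qed.

Fact quotient_1mul : right_id quotient_one quotient_mul.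
Proof. by elim/quotient_ind=> x; rewrite quotient_mulE mulg1. Qed.

Fact quotient_mulV : left_inverse quotient_one quotient_inv quotient_mul.
Proof.
by elim/quotient_ind=> x; rewrite quotient_invE quotient_mulE mulVg.
Qed.

Fact quotient_Vmul : right_inverse quotient_one quotient_inv quotient_mul.
Proof.
by elim/quotient_ind=> x; rewrite quotient_invE quotient_mulE mulgV.
Qed.

HB.instance Definition _ := isGroup.Build quotient_group
  quotient_mulA quotient_mul1 quotient_1mul quotient_mulV quotient_Vmul.

Definition quotient_map (x : T) : quotient_group := pi x.

Fact quotient_map_morphism : monoid_morphism quotient_map.
Proof. by split=> // x y; rewrite /quotient_map -quotient_mulE. Qed.

HB.instance Definition _ :=
  isUMagmaMorphism.Build T quotient_group quotient_map quotient_map_morphism.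

Lemma quotient_map_surj (q : quotient_group) : exists x, quotient_map x = q.
Proof. by exists (repr q); apply: reprK. Qed.

Lemma quotient_map_ker : hom_ker quotient_map = N.
Proof.
have [[N1 NM NV] NJ] := normal_subgroupP N.
apply/seteqP; split=> x /=.
  by move=> /quotient_eqP/NV; rewrite mulg1 invgK.
by move=> Nx; apply/quotient_eqP; rewrite mulg1; apply: NV.
Qed.

Section Lift.
Variables (K : groupType) (f : {hom T -> K}).
Hypothesis Nf : N `<=` hom_ker f.

Definition quotient_lift of N `<=` hom_ker f : quotient_group -> K :=
  fun q => f (repr q).

Lemma quotient_liftE x : quotient_lift Nf (quotient_map x) = f x.
Proof.
have /quotient_eqP /Nf /= : pi (repr (pi x)) = pi x by rewrite /pi reprK.
rewrite /hom_ker /= gmulfM gmulfV => e; rewrite /quotient_lift /quotient_map.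
by rewrite -[RHS](mulVKg (f (repr (pi x)))) e mulg1.
Qed.

Fact quotient_lift_morphism : monoid_morphism (quotient_lift Nf).
Proof.
split=> [|p q].
  by have <- : quotient_map 1 = 1; rewrite ?quotient_liftE gmulf1.
have [x <-] := quotient_map_surj p; have [y <-] := quotient_map_surj q.
by rewrite -gmulfM !quotient_liftE gmulfM.
Qed.

HB.instance Definition _ := isUMagmaMorphism.Build
  quotient_group K (quotient_lift Nf) quotient_lift_morphism.

End Lift.
End QuotientGroup.

(* The free product, as words in the disjoint union modulo the congruence     *)
(* that multiplies adjacent letters of the same factor and erases identities  *)

Section FreeProduct.
Variables G H : groupType.

Definition word : Type := seq (G + H)%type.

Inductive word_eq : word -> word -> Prop :=
| word_refl u : word_eq u u
| word_sym u v : word_eq u v -> word_eq v u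
| word_trans u v w : word_eq u v -> word_eq v w -> word_eq u w
| word_cat u u' v v' :
    word_eq u u' -> word_eq v v' -> word_eq (u ++ v) (u' ++ v')
| word_mull x y : word_eq [:: inl x; inl y] [:: inl (x * y)]
| word_mulr x y : word_eq [:: inr x; inr y] [:: inr (x * y)]
| word_1l : word_eq [:: inl 1] [::]
| word_1r : word_eq [:: inr 1] [::].

HB.instance Definition _ := Choice.on word.

Definition word_rel : rel word := fun u v => `[< word_eq u v >].

Fact word_rel_equiv : equiv_class_of word_rel.
Proof.
split=> [x|x y|y x z].
- exact/asboolP/word_refl.
- by apply: asbool_equiv_eq; split; apply: word_sym.
- by move=> /asboolP xy /asboolP yz; apply/asboolP; apply: word_trans xy yz.
Qed.

Canonical word_equiv := EquivRelPack word_rel_equiv.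

Definition free_product : Type := {eq_quot word_equiv}.

HB.instance Definition _ := Choice.on free_product.
HB.instance Definition _ := EqQuotient.on free_product.

Let pi : word -> free_product := \pi_free_product.

Lemma free_product_eqP u v : pi u = pi v <-> word_eq u v.
Proof. by split=> [/eqmodP/asboolP|/asboolP uv] //; apply/eqmodP. Qed.

Definition word_inv (w : word) : word :=
  rev [seq match a with inl x => inl x^-1 | inr y => inr y^-1 end | a <- w].

Definition fp_mul (p q : free_product) := pi (repr p ++ repr q).
Definition fp_inv (p : free_product) := pi (word_inv (repr p)).
Definition fp_one := pi [::].

Fact fp_mulE u v : fp_mul (pi u) (pi v) = pi (u ++ v).
Proof.
by apply/free_product_eqP; apply: word_cat; apply/free_product_eqP;
  apply: reprK.
Qed.

Fact fp_ind (P : free_product -> Prop) : (forall w, P (pi w)) -> forall p, P p.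
Proof. by move=> Ppi p; rewrite -[p]reprK. Qed.

Fact word_inv_cat u v : word_inv (u ++ v) = word_inv v ++ word_inv u.
Proof. by rewrite /word_inv map_cat rev_cat. Qed.

Fact word_invK : involutive word_inv.
Proof.
move=> w; rewrite /word_inv map_rev revK -map_comp map_id_in // => -[] x _ /=;
  by rewrite invgK.
Qed.

Fact word_inv_eq u v : word_eq u v -> word_eq (word_inv u) (word_inv v).
Proof.
elim=> {u v} [u|u v _|u v w _ + _|u u' v v' _ Eu _ Ev|x y|x y||].
- exact: word_refl.
- exact: word_sym.
- exact: word_trans.
- by rewrite !word_inv_cat; apply: word_cat.
- by rewrite /word_inv /= invgM; apply: word_mull.
- by rewrite /word_inv /= invgM; apply: word_mulr.
- by rewrite /word_inv /= invg1; apply: word_1l.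
- by rewrite /word_inv /= invg1; apply: word_1r.
Qed.

Fact fp_invE u : fp_inv (pi u) = pi (word_inv u).
Proof.
by apply/free_product_eqP; apply: word_inv_eq; apply/free_product_eqP;
  apply: reprK.
Qed.

Fact word_mulV w : word_eq (word_inv w ++ w) [::].
Proof.
elim: w => [|a w IHw]; first exact: word_refl.
rewrite -cat1s word_inv_cat -catA [_ ++ ([:: a] ++ w)]catA.
apply: word_trans IHw; apply: word_cat; first exact: word_refl.
rewrite -[w in word_eq _ w]cat0s; apply: word_cat; last exact: word_refl.
case: a => x; rewrite /word_inv /=.
  by apply: word_trans (word_mull _ _) _; rewrite mulVg; apply: word_1l.
by apply: word_trans (word_mulr _ _) _; rewrite mulVg; apply: word_1r.
Qed.

Fact fp_mulA : associative fp_mul.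
Proof.
by elim/fp_ind=> u; elim/fp_ind=> v; elim/fp_ind=> w; rewrite !fp_mulE catA.
Qed.

Fact fp_mul1 : left_id fp_one fp_mul.
Proof. by elim/fp_ind=> u; rewrite fp_mulE cat0s. Qed.

Fact fp_1mul : right_id fp_one fp_mul.
Proof. by elim/fp_ind=> u; rewrite fp_mulE cats0. Qed.

Fact fp_mulV : left_inverse fp_one fp_inv fp_mul.
Proof.
elim/fp_ind=> u; rewrite fp_invE fp_mulE.
exact/free_product_eqP/word_mulV.
Qed.

Fact fp_Vmul : right_inverse fp_one fp_inv fp_mul.
Proof.
elim/fp_ind=> u; rewrite fp_invE fp_mulE; apply/free_product_eqP.
by have := word_mulV (word_inv u); rewrite word_invK.
Qed.

HB.instance Definition _ := isGroup.Build free_product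
  fp_mulA fp_mul1 fp_1mul fp_mulV fp_Vmul.

Definition fp_inl (x : G) : free_product := pi [:: inl x].
Definition fp_inr (y : H) : free_product := pi [:: inr y].

Fact fp_inl_morphism : monoid_morphism fp_inl.
Proof.
split=> [|x y]; first exact/free_product_eqP/word_1l.
by rewrite [RHS]fp_mulE; apply/free_product_eqP/word_sym/word_mull.
Qed.

Fact fp_inr_morphism : monoid_morphism fp_inr.
Proof.
split=> [|x y]; first exact/free_product_eqP/word_1r.
by rewrite [RHS]fp_mulE; apply/free_product_eqP/word_sym/word_mulr.
Qed.

HB.instance Definition _ :=
  isUMagmaMorphism.Build G free_product fp_inl fp_inl_morphism.
HB.instance Definition _ :=
  isUMagmaMorphism.Build H free_product fp_inr fp_inr_morphism.

Lemma free_product_ind (P : free_product -> Prop) :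
    P 1 -> (forall x p, P p -> P (fp_inl x * p)) ->
    (forall y p, P p -> P (fp_inr y * p)) ->
  forall p, P p.
Proof.
move=> P1 Pl Pr; elim/fp_ind; elim=> [|[x|y] w IHw] //.
  by have := Pl x _ IHw; rewrite /fp_inl [X in P X]fp_mulE.
by have := Pr y _ IHw; rewrite /fp_inr [X in P X]fp_mulE.
Qed.

Section Lift.
Variables (K : groupType) (f : {hom G -> K}) (g : {hom H -> K}).

Definition word_eval (w : word) : K :=
  \prod_(a <- w) match a with inl x => f x | inr y => g y end.

Definition fp_lift (p : free_product) : K := word_eval (repr p).

Fact word_eval_eq u v : word_eq u v -> word_eval u = word_eval v.
Proof.
elim=> {u v} [u|u v _|u v w _ + _|u u' v v' _ Eu _ Ev|x y|x y||] //.
- by move=> -> ->.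
- by move: Eu Ev; rewrite /word_eval !big_cat /= => -> ->.
- by rewrite /word_eval !big_cons big_nil !mulg1 gmulfM.
- by rewrite /word_eval !big_cons big_nil !mulg1 gmulfM.
- by rewrite /word_eval !big_cons big_nil !mulg1 gmulf1.
- by rewrite /word_eval !big_cons big_nil !mulg1 gmulf1.
Qed.

Fact fp_liftE w : fp_lift (pi w) = word_eval w.
Proof. by apply: word_eval_eq; apply/free_product_eqP; apply: reprK. Qed.

Fact fp_lift_morphism : monoid_morphism fp_lift.
Proof.
split=> [|]; first by rewrite fp_liftE /word_eval big_nil.
elim/fp_ind=> u; elim/fp_ind=> v.
by rewrite [X in fp_lift X]fp_mulE !fp_liftE /word_eval big_cat.
Qed.

HB.instance Definition _ :=
  isUMagmaMorphism.Build free_product K fp_lift fp_lift_morphism.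

Lemma fp_lift_inl x : fp_lift (fp_inl x) = f x.
Proof. by rewrite fp_liftE /word_eval big_cons big_nil mulg1. Qed.

Lemma fp_lift_inr y : fp_lift (fp_inr y) = g y.
Proof. by rewrite fp_liftE /word_eval big_cons big_nil mulg1. Qed.

End Lift.
End FreeProduct.

Arguments fp_inl {G H} x.
Arguments fp_inr {G H} y.

(* G is embedded in G * G^* by fp_inl, and x^* is fp_inr x                    *)

Section NuTau.
Variable G : groupType.

Definition nu_relators : set (free_product G G) :=
  [set r | exists x y z : G,
    r = [~ fp_inl x, fp_inr y] ^ fp_inl z
          * [~ fp_inl (x ^ z), fp_inr (y ^ z)]^-1
    \/
    r = [~ fp_inl x, fp_inr y] ^ fp_inr z
          * [~ fp_inl (x ^ z), fp_inr (y ^ z)]^-1].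

Definition nu : Type :=
  quotient_group (NormalSubgroup (normal_closure_normal nu_relators)).

HB.instance Definition _ := Group.on nu.

Definition nu_quo : {hom free_product G G -> nu} := @quotient_map _ _.

Definition nu_l : {hom G -> nu} := nu_quo \o fp_inl.
Definition nu_r : {hom G -> nu} := nu_quo \o fp_inr.

Definition nabla : set nu :=
  subgroup_gen [set [~ nu_l x, nu_r x] | x in [set: G]].

Lemma nu_ind (P : nu -> Prop) :
    P 1 -> (forall x t, P t -> P (nu_l x * t)) ->
    (forall y t, P t -> P (nu_r y * t)) ->
  forall t, P t.
Proof.
move=> P1 Pl Pr t; have [p <-] := quotient_map_surj t.
rewrite -/(nu_quo p); elim/free_product_ind: p => [|x p Pp|y p Pp].
- by rewrite gmulf1.
- by rewrite gmulfM; apply: Pl.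
- by rewrite gmulfM; apply: Pr.
Qed.

Fact nu_quo_eq1 r : nu_relators r -> nu_quo r = 1.
Proof.
move=> rel_r; suff: hom_ker nu_quo r by [].
by rewrite quotient_map_ker; apply: sub_normal_closure.
Qed.

Lemma nu_commJl x y z :
  [~ nu_l x, nu_r y] ^ nu_l z = [~ nu_l (x ^ z), nu_r (y ^ z)].
Proof.
apply: divg1_eq; rewrite /= -!gmulfR -gmulfJ -gmulfF.
by apply: nu_quo_eq1; exists x, y, z; left.
Qed.

Lemma nu_commJr x y z :
  [~ nu_l x, nu_r y] ^ nu_r z = [~ nu_l (x ^ z), nu_r (y ^ z)].
Proof.
apply: divg1_eq; rewrite /= -!gmulfR -gmulfJ -gmulfF.
by apply: nu_quo_eq1; exists x, y, z; right.
Qed.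

Lemma nabla_normal : is_normal_subgroup nabla.
Proof.
have sgN : is_subgroup nabla by exact: subgroup_gen_subgroup.
have [N1 NM NV] := sgN; split=> // a t.
have NJ u : (forall x, nabla ([~ nu_l x, nu_r x] ^ u)) ->
    forall b, nabla b -> nabla (b ^ u).
  move=> Nu; apply: smallest_sub; last by move=> _ [x _ <-]; apply: Nu.
  split=> /= [|b c Nb Nc|b Nb]; first by rewrite conj1g.
    by rewrite conjMg; apply: NM.
  by rewrite conjVg; apply: NV.
elim/nu_ind: t a => [|x t IHt|y t IHt] a Na; first by rewrite conjg1.
  rewrite conjgM; apply: IHt; apply: NJ Na => z; rewrite nu_commJl.
  by apply: sub_subgroup_gen; exists (z ^ x).
rewrite conjgM; apply: IHt; apply: NJ Na => z; rewrite nu_commJr.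
by apply: sub_subgroup_gen; exists (z ^ y).
Qed.

Definition tau : Type := quotient_group (NormalSubgroup nabla_normal).

HB.instance Definition _ := Group.on tau.

Definition tau_quo : {hom nu -> tau} := @quotient_map _ _.

Definition tau_l : {hom G -> tau} := tau_quo \o nu_l.
Definition tau_r : {hom G -> tau} := tau_quo \o nu_r.

Lemma tau_ind (P : tau -> Prop) :
    P 1 -> (forall x t, P t -> P (tau_l x * t)) ->
    (forall y t, P t -> P (tau_r y * t)) ->
  forall t, P t.
Proof.
move=> P1 Pl Pr t; have [p <-] := quotient_map_surj t.
rewrite -/(tau_quo p); elim/nu_ind: p => [|x p Pp|y p Pp].
- by rewrite gmulf1.
- by rewrite gmulfM; apply: Pl.
- by rewrite gmulfM; apply: Pr.
Qed.

Section Lift.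
Variables (K : groupType) (f g : {hom G -> K}).

Definition tau_compatible :=
  [/\ forall x y z, [~ f x, g y] ^ f z = [~ f (x ^ z), g (y ^ z)],
      forall x y z, [~ f x, g y] ^ g z = [~ f (x ^ z), g (y ^ z)]
    & forall x, [~ f x, g x] = 1].

Hypothesis fg : tau_compatible.

Fact nu_lift_subproof : normal_closure nu_relators `<=` hom_ker (fp_lift f g).
Proof.
have [fgl fgr _] := fg; apply: smallest_sub.
  exact: hom_ker_normal.
move=> _ [x [y [z [->|->]]]]; rewrite /hom_ker /= gmulfF gmulfJ !gmulfR;
  by rewrite /= !fp_lift_inl !fp_lift_inr ?fgl ?fgr divgg.
Qed.

Definition nu_lift : {hom nu -> K} :=
  @quotient_lift _ (NormalSubgroup (normal_closure_normal nu_relators)) _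
    _ nu_lift_subproof.

Lemma nu_lift_l x : nu_lift (nu_l x) = f x.
Proof.
apply: etrans (fp_lift_inl f g x).
exact: (@quotient_liftE _ (NormalSubgroup (normal_closure_normal nu_relators))
  _ _ nu_lift_subproof).
Qed.

Lemma nu_lift_r x : nu_lift (nu_r x) = g x.
Proof.
apply: etrans (fp_lift_inr f g x).
exact: (@quotient_liftE _ (NormalSubgroup (normal_closure_normal nu_relators))
  _ _ nu_lift_subproof).
Qed.

Fact tau_lift_subproof : nabla `<=` hom_ker nu_lift.
Proof.
have [_ _ fg1] := fg; apply: smallest_sub.
  by case: (hom_ker_normal nu_lift).
move=> _ [x _ <-]; suff: nu_lift [~ nu_l x, nu_r x] = 1 by [].
by rewrite gmulfR nu_lift_l nu_lift_r.
Qed.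

Definition tau_lift : {hom tau -> K} :=
  @quotient_lift _ (NormalSubgroup nabla_normal) _ _ tau_lift_subproof.

Lemma tau_lift_l x : tau_lift (tau_l x) = f x.
Proof.
apply: etrans (nu_lift_l x).
exact: (@quotient_liftE _ (NormalSubgroup nabla_normal) _ _ tau_lift_subproof).
Qed.

Lemma tau_lift_r x : tau_lift (tau_r x) = g x.
Proof.
apply: etrans (nu_lift_r x).
exact: (@quotient_liftE _ (NormalSubgroup nabla_normal) _ _ tau_lift_subproof).
Qed.

End Lift.

(* The non-abelian exterior square, as the subgroup [G, G^*] of tau(G)        *)
Definition ext_square_subgroup : subgroup tau :=
  Subgroup
    (subgroup_gen_subgroup [set t | exists g h, t = [~ tau_l g, tau_r h]]).

Definition ext_square : Type := subgroup_of ext_square_subgroup.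

HB.instance Definition _ := Group.on ext_square.

Fact wedge_subproof g h :
  subgroup_pred ext_square_subgroup [~ tau_l g, tau_r h].
Proof. by apply/asboolP; apply: sub_subgroup_gen => /=; exists g, h. Qed.

Definition wedge g h : ext_square := SubgroupElt (wedge_subproof g h).

Definition ext_square_incl : ext_square -> tau := val.

End NuTau.

Arguments nu_l {G}.
Arguments nu_r {G}.
Arguments tau_l {G}.
Arguments tau_r {G}.
Arguments ext_square_incl {G}.


Section FiniteGroup.
Variable gT : finGroupType.

Local Notation G := [set: gT]%SET.

(* G^n is {ffun 'I_n -> gT}, with its pointwise group structure               *)
Definition K_set n : {set {ffun 'I_n -> gT}} :=
  [set f : {ffun 'I_n -> gT} | \prod_(i < n) f i \in G^`(1)]%SET.

Definition AI_automorphism (alpha : {perm gT}) : Prop :=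
  alpha \in Aut G /\
  forall g, coset G^`(1) (alpha g) = (coset G^`(1) g)^-1.

Lemma AI_automorphism_Aut alpha : AI_automorphism alpha -> alpha \in Aut G.
Proof. by case. Qed.

Fact id_tau_compatible : @tau_compatible gT gT idfun idfun.
Proof. by split=> x *; rewrite /= ?conjRg ?commgg. Qed.

(* tau_mul identifies the two copies of G, so that it maps [g, h^*] to        *)
(* [g, h]; the commutator map kappa is its restriction to the exterior square *)
Definition tau_mul : {hom tau gT -> gT} := tau_lift id_tau_compatible.

Fact tau_mul_ext_square (t : ext_square gT) : tau_mul (val t) \in G^`(1).
Proof.
pose P s : Prop := tau_mul s \in G^`(1).
have P1 : P 1 by rewrite /P gmulf1.
have PM x y : P x -> P y -> P (x * y) by rewrite /P gmulfM; apply: groupM.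
have PV x : P x -> P x^-1 by rewrite /P gmulfV groupV.
have PR g h : P [~ tau_l g, tau_r h].
  by rewrite /P gmulfR tau_lift_l tau_lift_r mem_commg ?inE.
have: subgroup_set (ext_square_subgroup gT) `<=` P.
  by apply: smallest_sub => // _ [g [h ->]].
by apply; apply: subgroup_ofP.
Qed.

Definition kappa_fun (t : ext_square gT) : [subg G^`(1)] :=
  subg _ (tau_mul (val t)).

Fact kappa_morphism : monoid_morphism kappa_fun.
Proof.
split=> [|s t]; apply: val_inj; rewrite /kappa_fun.
  by rewrite val1 gmulf1 subgK.
by rewrite valM gmulfM subgM ?tau_mul_ext_square.
Qed.

HB.instance Definition _ := isUMagmaMorphism.Build
  (ext_square gT) [subg G^`(1)]%type kappa_fun kappa_morphism.

Definition kappa : {hom ext_square gT -> [subg G^`(1)]} := kappa_fun.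

Lemma kappa_wedge g h : sgval (kappa (wedge g h)) = [~ g, h].
Proof.
have -> : sgval (kappa (wedge g h)) = tau_mul [~ tau_l g, tau_r h].
  exact: subgK (tau_mul_ext_square (wedge g h)).
by rewrite gmulfR tau_lift_l tau_lift_r.
Qed.

Definition triple (a b c : gT) : {ffun 'I_3 -> gT} :=
  [ffun i : 'I_3 => nth 1 [:: a; b; c] i].

Lemma triple1 : triple 1 1 1 = 1.
Proof. by apply/ffunP=> -[[|[|[|//]]] ?]; rewrite [LHS]ffunE [RHS]ffunE. Qed.

Lemma tripleM a b c a' b' c' :
  triple a b c * triple a' b' c' = triple (a * a') (b * b') (c * c').
Proof. by apply/ffunP=> -[[|[|[|//]]] ?]; rewrite [LHS]ffunE !ffunE. Qed.

Section Phi.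
Variables (alpha : {perm gT}) (alpha_Aut : alpha \in Aut G).

Fact AutM : {morph alpha : x y / x * y}.
Proof. by move=> x y; rewrite -(autmE alpha_Aut) morphM ?inE. Qed.

Fact Aut1 : alpha 1 = 1.
Proof. by rewrite -(autmE alpha_Aut) morph1. Qed.

Definition Phi_l_fun of alpha \in Aut G := fun g => triple g 1 (alpha g).
Definition Phi_r_fun of alpha \in Aut G := fun h => triple 1 h (alpha h).

Fact Phi_l_morphism : monoid_morphism (Phi_l_fun alpha_Aut).
Proof.
split=> [|x y]; rewrite /Phi_l_fun ?Aut1 ?triple1 //.
by rewrite tripleM mulg1 AutM.
Qed.

Fact Phi_r_morphism : monoid_morphism (Phi_r_fun alpha_Aut).
Proof.
split=> [|x y]; rewrite /Phi_r_fun ?Aut1 ?triple1 //.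
by rewrite tripleM mulg1 AutM.
Qed.

HB.instance Definition _ := isUMagmaMorphism.Build
  gT {ffun 'I_3 -> gT} (Phi_l_fun alpha_Aut) Phi_l_morphism.
HB.instance Definition _ := isUMagmaMorphism.Build
  gT {ffun 'I_3 -> gT} (Phi_r_fun alpha_Aut) Phi_r_morphism.

Definition Phi_l : {hom gT -> {ffun 'I_3 -> gT}} := Phi_l_fun alpha_Aut.
Definition Phi_r : {hom gT -> {ffun 'I_3 -> gT}} := Phi_r_fun alpha_Aut.

Fact tripleV a b c : (triple a b c)^-1 = triple a^-1 b^-1 c^-1.
Proof. by apply/ffunP=> -[[|[|[|//]]] ?]; rewrite [LHS]ffunE !ffunE. Qed.

Fact Phi_compatible : tau_compatible Phi_l Phi_r.
Proof.
have AV x : alpha x^-1 = (alpha x)^-1.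
  by apply: (mulgI (alpha x)); rewrite -AutM !mulgV Aut1.
split=> [x y z|x y z|x] /=; rewrite /Phi_l_fun /Phi_r_fun /commg /conjg;
  rewrite !(tripleV, tripleM, AutM, AV, invg1, mulg1, mul1g);
  rewrite ?(mulVg, mulgV, mulVKg, mulKVg, mulKg, invgM, invgK, triple1) //.
all: by rewrite -?triple1; congr triple; rewrite ?mulgA
  ?(mulgK, mulgKV, mulVg, mulgV, mulg1, mul1g).
Qed.

Definition Phi : {hom tau gT -> {ffun 'I_3 -> gT}} := tau_lift Phi_compatible.

(* Every element of tau(G) is such a product, as g and h may be 1             *)
Lemma Phi_prod (s : seq (gT * gT)) :
  Phi (\prod_(gh <- s) (tau_l gh.1 * tau_r gh.2)) =
  triple (\prod_(gh <- s) gh.1) (\prod_(gh <- s) gh.2)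
    (alpha (\prod_(gh <- s) (gh.1 * gh.2))).
Proof.
elim: s => [|[g h] s IHs]; first by rewrite !big_nil gmulf1 Aut1 triple1.
rewrite !big_cons gmulfM IHs gmulfM tau_lift_l tau_lift_r /=.
by rewrite /Phi_l_fun /Phi_r_fun !tripleM !AutM mulg1 mul1g.
Qed.

End Phi.
End FiniteGroup.

(* Main.v *)
Require Import Defs.
From mathcomp Require Import all_boot all_fingroup all_solvable.
From mathcomp Require Import boolp classical_sets.

Local Open Scope group_scope.
Local Open Scope classical_set_scope.

(** Write x for [tau_l x], x^* for [tau_r x] and E for the subgroup [G, G^*]
    of tau(G), on which kappa is the restriction of [tau_mul].

    Since E is normal, every element of tau(G) has the form a b^* w with w in
    E ([tau_decomposition]), and Phi_alpha maps it to
    (a, b, alpha (a b kappa w)) ([Phi_decomposition]). Hence the kernel of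
    Phi_alpha consists of the w in E with kappa w = 1. As alpha inverts G
    modulo G', the triple (a, b, alpha y) is in K(G, 3) if and only if y is in
    the coset (a b) G' ([triple_alpha_in_K]); every triple has this form, and
    kappa maps E onto G' ([ext_lift]), so the image is K(G, 3).

    The centrality of ker kappa rests on the fact that w in E and the copy of
    kappa w in G act in the same way by conjugation on the subgroup G^* E
    ([conj_ext_square]). As G^* E is normalised by G, it suffices to check this
    for w = [g, h^*]. On E it holds because z and z^* act alike there
    ([ext_conj_lr]); on G^* it follows from the identity
    (u^* ^ x) ^ h^* = (u ^ h)^* ^ (x ^ h). So an element w of ker kappa commutes
    with G^*, and then also with G, because w ^ z = w ^ z^* = w. *)

Lemma conjg_commE {T : groupType} (x y : T) : x ^ y = x * [~ x, y].
Proof. by rewrite commgEl mulVKg. Qed.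

(** * The subgroup [G, G^*] of tau(G) *)

Section ExteriorSquare.
Context {G : groupType}.
Implicit Types (g h x y z a b : G) (t w c : tau G).

Local Notation E := (subgroup_set (ext_square_subgroup G)).

Lemma ext_gen g h : E [~ tau_l g, tau_r h].
Proof. by apply: sub_subgroup_gen; exists g, h. Qed.

Lemma ext1 : E 1.
Proof. by case: (subgroupP (ext_square_subgroup G)). Qed.

Lemma extM w c : E w -> E c -> E (w * c).
Proof. by case: (subgroupP (ext_square_subgroup G)) => _ + _; apply. Qed.

Lemma extV w : E w -> E w^-1.
Proof. by case: (subgroupP (ext_square_subgroup G)) => _ _; apply. Qed.

Lemma ext_gen_rl x y : E [~ tau_r y, tau_l x].
Proof. by rewrite -invgR; apply: extV; apply: ext_gen. Qed.

(** Induction over the elements of E as products of commutators [g, h^*] and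
    their inverses. *)
Lemma ext_ind (P : tau G -> Prop) :
    P 1 -> (forall w c, E w -> E c -> P w -> P c -> P (w * c)) ->
    (forall w, E w -> P w -> P w^-1) ->
    (forall g h, P [~ tau_l g, tau_r h]) ->
  forall w, E w -> P w.
Proof.
move=> P1 PM PV Pgen w Ew.
suff: E `<=` [set t | E t /\ P t] by move=> /(_ _ Ew)[].
apply: smallest_sub => [|_ [g [h ->]]]; last by split; first exact: ext_gen.
split=> [|s t [Es Ps] [Et Pt]|s [Es Ps]].
- by split; first exact: ext1.
- by split; [exact: extM | exact: PM].
- by split; [exact: extV | exact: PV].
Qed.

Lemma tau_commJl x y z :
  [~ tau_l x, tau_r y] ^ tau_l z = [~ tau_l (x ^ z), tau_r (y ^ z)].
Proof.
have tauE a b : [~ tau_l a, tau_r b] = tau_quo G [~ nu_l a, nu_r b].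
  by rewrite [RHS]gmulfR.
by rewrite !tauE -nu_commJl [RHS]gmulfJ.
Qed.

Lemma tau_commJr x y z :
  [~ tau_l x, tau_r y] ^ tau_r z = [~ tau_l (x ^ z), tau_r (y ^ z)].
Proof.
have tauE a b : [~ tau_l a, tau_r b] = tau_quo G [~ nu_l a, nu_r b].
  by rewrite [RHS]gmulfR.
by rewrite !tauE -nu_commJr [RHS]gmulfJ.
Qed.

(** The two copies of G act alike on [G, G^*]. *)
Lemma ext_conj_lr w z : E w -> w ^ tau_l z = w ^ tau_r z.
Proof.
move=> Ew; elim/ext_ind: w / Ew => [|w c _ _ Hw Hc|w _ Hw|g h].
- by rewrite !conj1g.
- by rewrite !conjMg Hw Hc.
- by rewrite !conjVg Hw.
- by rewrite tau_commJl tau_commJr.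
Qed.

Lemma extJl w z : E w -> E (w ^ tau_l z).
Proof.
move=> Ew; elim/ext_ind: w / Ew => [|w c _ _ Hw Hc|w _ Hw|g h].
- by rewrite conj1g; apply: ext1.
- by rewrite conjMg; apply: extM.
- by rewrite conjVg; apply: extV.
- by rewrite tau_commJl; apply: ext_gen.
Qed.

Lemma extJr w z : E w -> E (w ^ tau_r z).
Proof. by move=> Ew; rewrite -ext_conj_lr //; apply: extJl. Qed.

Lemma tau_decomposition t :
  exists a b w, E w /\ t = tau_l a * tau_r b * w.
Proof.
elim/tau_ind: t => [|x _ [a [b [w [Ew ->]]]]|y _ [a [b [w [Ew ->]]]]].
- by exists 1, 1, 1; split; [exact: ext1 | rewrite !gmulf1 !mulg1].
- by exists (x * a), b, w; split; rewrite // gmulfM !mulgA.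
- exists a, (y * b), ([~ tau_r y, tau_l a] ^ tau_r b * w); split.
    by apply: extM => //; apply: extJr; apply: ext_gen_rl.
  (* y^* a b^* = a y^* [y^*, a] b^* = a y^* b^* [y^*, a] ^ b^* *)
  by rewrite gmulfM /commg /conjg !mulgA !mulgK mulgV mul1g.
Qed.

(** Indeed u^* ^ x = u^* [u^*, x], and h^* acts on the factor [u^*, x] of E as
    h does. *)
Lemma tau_conj_rJr u x h :
  (tau_r u ^ tau_l x) ^ tau_r h = tau_r (u ^ h) ^ tau_l (x ^ h).
Proof.
rewrite [tau_r u ^ _]conjg_commE [RHS]conjg_commE conjMg -gmulfJ; congr (_ * _).
by rewrite -invgR conjVg tau_commJr invgR.
Qed.

Lemma tau_commE g h :
  [~ tau_l g, tau_r h] = tau_l g^-1 * tau_r h^-1 * tau_l g * tau_r h.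
Proof. by rewrite !gmulfV /commg /conjg !mulgA. Qed.

(** The commutator [g, h^*] acts on G^* as [g, h] does. *)
Lemma tau_r_conj_commg g h z :
  tau_r z ^ [~ tau_l g, tau_r h] = tau_r z ^ tau_l [~ g, h].
Proof.
rewrite tau_commE 3!conjgM tau_conj_rJr -[(_ ^ _) ^ tau_l g]conjgM -gmulfM.
by rewrite tau_conj_rJr [(_ * g) ^ h]conjMg !conjgKV -commgEl.
Qed.

(** G^* E is normalised by G. *)
Lemma right_extJ (t : tau G) x :
  (exists y c, E c /\ t = tau_r y * c) ->
  exists y c, E c /\ t ^ tau_l x = tau_r y * c.
Proof.
move=> [y [c [Ec ->]]]; exists y, ([~ tau_r y, tau_l x] * c ^ tau_l x).
split; last by rewrite conjMg (conjg_commE (tau_r y)) -mulgA.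
by apply: extM; [apply: ext_gen_rl | apply: extJl].
Qed.

End ExteriorSquare.

(** * The commutator map *)

Section CommutatorMap.
Context {gT : finGroupType}.
Implicit Types (g h x y z a b : gT) (t w c : tau gT).

Local Notation E := (subgroup_set (ext_square_subgroup gT)).

Lemma tau_mul_l x : tau_mul gT (tau_l x) = x.
Proof. exact: tau_lift_l. Qed.

Lemma tau_mul_r x : tau_mul gT (tau_r x) = x.
Proof. exact: tau_lift_r. Qed.

(** On the normal subgroup G^* E of tau(G), an element w of E acts by
    conjugation as kappa w does. *)
Lemma conj_ext_square w : E w ->
  forall t, (exists y c, E c /\ t = tau_r y * c) ->
  t ^ w = t ^ tau_l (tau_mul gT w).
Proof.
move=> Ew; elim/(@ext_ind gT): w / Ew => [|w c _ _ Hw Hc|w _ Hw|g h] t Ht.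
- by rewrite !gmulf1 !conjg1.
- by rewrite !gmulfM !conjgM Hw // Hc //; apply: right_extJ.
- (* the property of w, applied to the conjugate of t by kappa w^-1 *)
  apply: (conjg_inj w); rewrite conjgKV Hw; last exact: right_extJ.
  by rewrite !gmulfV conjgKV.
- case: Ht => [y [c [Ec ->]]].
  rewrite gmulfR tau_mul_l tau_mul_r !conjMg tau_r_conj_commg; congr (_ * _).
  have -> : [~ g, h] = g^-1 * h^-1 * g * h by rewrite /commg /conjg !mulgA.
  rewrite tau_commE !gmulfM !conjgM.
  by rewrite -!ext_conj_lr //; do ?apply: extJl.
Qed.

Lemma ker_kappaP t :
  (ext_square_incl @` hom_ker (kappa gT)) t <-> E t /\ tau_mul gT t = 1.
Proof.
split=> [[w kw <-]|[/asboolP Et mt]].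
  split; first exact: subgroup_ofP.
  rewrite -[LHS](@subgK _ _ _ (tau_mul_ext_square w)).
  by rewrite -[subg _ _]/(kappa gT w) kw.
exists (SubgroupElt Et) => //; apply: val_inj.
by rewrite [LHS](@subgK _ _ _ (tau_mul_ext_square (SubgroupElt Et))).
Qed.

Lemma ker_kappa_central :
  ext_square_incl @` hom_ker (kappa gT) `<=` group_center (tau gT).
Proof.
move=> w /ker_kappaP[Ew mw].
have commr z : w ^ tau_r z = w.
  have: tau_r z ^ w = tau_r z.
    rewrite (conj_ext_square _ Ew); first by rewrite mw gmulf1 conjg1.
    by exists z, 1; split; [exact: ext1 | rewrite mulg1].
  by move=> /conjg_fixP; rewrite commg1_sym => /conjg_fixP.
have commt t : w ^ t = w.
  elim/tau_ind: t => [|x t IHt|y t IHt]; first by rewrite conjg1.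
    by rewrite conjgM ext_conj_lr // commr.
  by rewrite conjgM commr.
by move=> t; rewrite /commute conjgC commt.
Qed.

(** kappa is onto G'. *)
Lemma ext_lift d : d \in [set: gT]%SET^`(1) ->
  exists2 w, E w & tau_mul gT w = d.
Proof.
move=> /gen_prodgP[n [c Hc ->]].
have /choice[w Hw] i : exists w, E w /\ tau_mul gT w = c i.
  have /imset2P[g h _ _ ->] := Hc i.
  exists [~ tau_l g, tau_r h]; split; first exact: ext_gen.
  by rewrite gmulfR tau_mul_l tau_mul_r.
exists (\prod_(i < n) w i).
  by elim/big_rec: _ => [|i v _]; [exact: ext1 | apply: extM; case: (Hw i)].
by rewrite gmulf_prod; apply: eq_bigr => i _; case: (Hw i).
Qed.

End CommutatorMap.

(** * The image and the kernel of Phi_alpha *)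

Section Phi.
Context {gT : finGroupType} {alpha : {perm gT}}.
Context (AI_alpha : AI_automorphism alpha).

Local Notation G := [set: gT]%SET.
Local Notation E := (subgroup_set (ext_square_subgroup gT)).
Local Notation alpha_Aut := (AI_automorphism_Aut AI_alpha).
Local Notation Phi_alpha := (Phi alpha_Aut).

Lemma triple_inj (a b c a' b' c' : gT) :
  triple a b c = triple a' b' c' -> [/\ a = a', b = b' & c = c'].
Proof.
move=> /ffunP e; split.
- by have := e (@Ordinal 3 0 isT); rewrite !ffunE.
- by have := e (@Ordinal 3 1 isT); rewrite !ffunE.
- by have := e (@Ordinal 3 2 isT); rewrite !ffunE.
Qed.

Lemma triple_in_K (a b c : gT) :
  (triple a b c \in K_set gT 3) = (a * b * c \in G^`(1)).
Proof. by rewrite inE !big_ord_recl big_ord0 !ffunE /= mulg1 mulgA. Qed.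

Lemma tripleE (f : {ffun 'I_3 -> gT}) : exists a b c, f = triple a b c.
Proof.
exists (f (@Ordinal 3 0 isT)), (f (@Ordinal 3 1 isT)), (f (@Ordinal 3 2 isT)).
by apply/ffunP=> -[[|[|[|//]]] ?]; rewrite ffunE; congr (f _); apply: val_inj.
Qed.

Lemma Phi_ext w : E w -> Phi_alpha w = triple 1 1 (alpha (tau_mul gT w)).
Proof.
move=> Ew; elim/(@ext_ind gT): w / Ew => [|w c _ _ Hw Hc|w _ Hw|g h].
- by rewrite !gmulf1 (Defs.Aut1 alpha_Aut) ?triple1.
- by rewrite !gmulfM Hw Hc tripleM !mulg1 (Defs.AutM alpha_Aut).
- apply: (mulgI (Phi_alpha w)); rewrite -gmulfM mulgV gmulf1 Hw tripleM.
  rewrite -(Defs.AutM alpha_Aut) gmulfV mulgV (Defs.Aut1 alpha_Aut) mulg1.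
  by rewrite triple1.
- rewrite [tau_mul _ _]gmulfR tau_mul_l tau_mul_r.
  have := Phi_prod alpha_Aut [:: (g^-1, h^-1); (g, h)].
  rewrite !big_cons !big_nil /= !mulg1 !mulVg mulgA -tau_commE => ->.
  by rewrite /commg /conjg !mulgA.
Qed.

Lemma Phi_decomposition a b w : E w ->
  Phi_alpha (tau_l a * tau_r b * w) =
    triple a b (alpha (a * b * tau_mul gT w)).
Proof.
have Phi_ab : Phi_alpha (tau_l a * tau_r b) = triple a b (alpha (a * b)).
  have := Phi_prod alpha_Aut [:: (a, b)].
  by rewrite !big_cons !big_nil !mulg1.
move=> Ew; rewrite [LHS]gmulfM Phi_ab Phi_ext //.
by rewrite tripleM !mulg1 -(Defs.AutM alpha_Aut).
Qed.

Lemma norm_der1 x : x \in 'N(G^`(1)).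
Proof. by have /fintype.subsetP := der_norm 1 G; apply; rewrite inE. Qed.

Lemma mem_der1 x : (x \in G^`(1)) = (coset G^`(1) x == 1).
Proof.
apply/idP/eqP => [/coset_id //|]; exact/coset_idr/norm_der1.
Qed.

Lemma coset_der1M x y :
  coset G^`(1) (x * y) = coset G^`(1) x * coset G^`(1) y.
Proof. by rewrite morphM ?norm_der1. Qed.

(** Modulo G', alpha is inversion, so (a, b, alpha y) is in K(G, 3) exactly when
    y is congruent to a b. *)
Lemma triple_alpha_in_K a b y :
  (triple a b (alpha y) \in K_set gT 3) = ((a * b)^-1 * y \in G^`(1)).
Proof.
have [_ AI] := AI_alpha; rewrite triple_in_K !mem_der1 coset_der1M AI.
rewrite [in RHS]coset_der1M morphV ?norm_der1 // !mulg_eq1 invgK.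
by rewrite eqg_inv.
Qed.

Lemma range_Phi : range Phi_alpha = [set` K_set gT 3].
Proof.
apply/seteqP; split=> [_ [t _ <-]|f fK].
  have [a [b [w [Ew ->]]]] := tau_decomposition t.
  suff: Phi_alpha (tau_l a * tau_r b * w) \in K_set gT 3 by [].
  rewrite Phi_decomposition // triple_alpha_in_K mulKg.
  exact: (tau_mul_ext_square (SubgroupElt (asboolT Ew))).
have [a [b [c def_f]]] := tripleE f.
have: f \in K_set gT 3 by [].
rewrite def_f -[c](permKV alpha) triple_alpha_in_K => /ext_lift[w Ew mw].
by exists (tau_l a * tau_r b * w); rewrite // Phi_decomposition // mw mulVKg.
Qed.

Lemma ker_Phi : hom_ker Phi_alpha = ext_square_incl @` hom_ker (kappa gT).
Proof.
apply/seteqP; split=> t; last first.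
  move=> /ker_kappaP[Et mt]; suff: Phi_alpha t = 1 by [].
  by rewrite Phi_ext // mt (Defs.Aut1 alpha_Aut) triple1.
have [a [b [w [Ew ->]]]] := tau_decomposition t.
rewrite /hom_ker mksetE Phi_decomposition // -triple1 => /triple_inj[-> ->].
rewrite !gmulf1 !mul1g => mw; apply/ker_kappaP; split=> //.
by apply: (@perm_inj _ alpha); rewrite mw (Defs.Aut1 alpha_Aut).
Qed.

End Phi.

Theorem theorem4p3 (gT : finGroupType) (alpha : {perm gT})
    (AI_alpha : AI_automorphism alpha) :
  let Phi_alpha := Phi (AI_automorphism_Aut AI_alpha) in
  [/\ range Phi_alpha = [set` K_set gT 3],
      hom_ker Phi_alpha = ext_square_incl @` hom_ker (kappa gT)
    & ext_square_incl @` hom_ker (kappa gT) `<=` group_center (tau gT)].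
Proof.
by split; [exact: range_Phi | exact: ker_Phi | exact: ker_kappa_central].
Qed.
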